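(* (a) For all real $h_*>0$ and any $c\in\mathbb{R}$ the constant function $h=h_*$ is a solution of the problem $$-ch+\frac{h^2}{2}+h^3(\partial_\theta h+\partial_\theta^3h)=J,\qquad h(\theta+2\pi)=h(\theta)\ \ (\theta\in\mathbb{R}),\qquad(\ast)$$ with $J=-ch_*+\frac{h_*^2}{2}$. Moreover, for any $L>0$ there exists $\varepsilon=\varepsilon(L)>0$ such that for each $c\in[-L,L]$ and $\frac1L\le h_*\le L$ for which $J=-ch_*+\frac{h_*^2}{2}\in[-\frac{c^2}{2},L]$, and any solution $h$ of $(\ast)$ with this $J$ satisfying $\|h-h_*\|_{L^\infty}\le\varepsilon$, we have that $h$ is a constant $\tilde h\in\mathcal{S}_{\varepsilon,h_*,c}$, where $$\mathcal{S}_{\varepsilon,h_*,c}=\Big\{x\in[h_*-\varepsilon,h_*+\varepsilon]:-cx+\frac{x^2}{2}=-ch_*+\frac{h_*^2}{2}\Big\}.$$ (b) For all real $h_*>0$ and any $c\in\mathbb{R}$ the constant function $h=h_*$ is a solution of the problem $$-ch+h^3(\partial_\theta h+\partial_\theta^3h)=J,\qquad h(\theta+2\pi)=h(\theta)\ \ (\theta\in\mathbb{R}),\qquad(\ast\ast)$$ with $J=-ch_*$. Moreover, for any $L>0$ there exists $\varepsilon=\varepsilon(L)>0$ such that for each $\frac1L\le c\le L$ and $h_*>0$ for which $J=-ch_*\in[-L,L]$, and any solution $h$ of $(\ast\ast)$ with this $J$ satisfying $\|h-h_*\|_{L^\infty}\le\varepsilon$, we have $h=h_*$.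
   Context: Here $c,J$ are real constants. Solutions $h$ are real-valued (three times differentiable) and, throughout, only positive functions $h>0$ are considered. $L^\infty$ norms are over one period. *)

(* Defs.v *)
From HB Require Import structures.
From mathcomp Require Import all_boot all_order all_algebra.
From mathcomp Require Import all_classical all_reals all_analysis.

Set Implicit Arguments.
Unset Strict Implicit.
Unset Printing Implicit Defensive.

Import Order.TTheory GRing.Theory Num.Theory.
Import numFieldNormedType.Exports.

Local Open Scope classical_set_scope.
Local Open Scope ring_scope.

Definition thrice_differentiable (R : realType) (h : R -> R) : Prop :=
  forall (k : nat) (theta : R), (k < 3)%N -> derivable (h^`(k))%classic theta 1.

(* The left-hand sides of the two equations differ only in the zeroth-order
   term F(h): F(y) = - c y + y^2 / 2 for the first and F(y) = - c y for the
   second. *)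
Definition positive_periodic_solution (R : realType)
    (F : R -> R) (J : R) (h : R -> R) : Prop :=
  [/\ thrice_differentiable h,
      forall theta, 0 < h theta,
      periodic h (2 * pi) &
      forall theta,
        F (h theta) + h theta ^+ 3 * ((h^`(1))%classic theta + (h^`(3))%classic theta) = J].

Definition solution_a (R : realType) (c J : R) (h : R -> R) : Prop :=
  positive_periodic_solution (fun y => - c * y + y ^+ 2 / 2) J h.

Definition solution_b (R : realType) (c J : R) (h : R -> R) : Prop :=
  positive_periodic_solution (fun y => - c * y) J h.

(* L^oo norm over the period [0, 2 pi], as an extended real. *)
Definition Linfty_norm (R : realType) (f : R -> R) : \bar R :=
  ('N[mrestr (@lebesgue_measure R) (measurable_itv `[0%R, (2 * pi)%R])]_+oo
     [EFin \o f])%E.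

Definition constant_states (R : realType) (eps hstar c : R) : set R :=
  [set x | x \in `[hstar - eps, hstar + eps] /\
           - c * x + x ^+ 2 / 2 = - c * hstar + hstar ^+ 2 / 2].

(* Main.v *)
Require Import Defs.
From HB Require Import structures.
From mathcomp Require Import all_boot all_order all_algebra.
From mathcomp Require Import all_classical all_reals all_analysis.
From mathcomp Require Import ess_sup_inf ring.

Set Implicit Arguments.
Unset Strict Implicit.
Unset Printing Implicit Defensive.

Import Order.TTheory GRing.Theory Num.Theory.
Import numFieldNormedType.Exports.

Local Open Scope classical_set_scope.
Local Open Scope ring_scope.

(* Divide the equation by h^3 and multiply it by h'. The right-hand side
   (J - F(h)) h' / h^3 and the sum h' h''' + h''^2 are derivatives of periodic
   functions, so h'^2 and h''^2 have the same integral over a period. This is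
   the equality case of Wirtinger's inequality for h', hence h' + h''' = 0,
   hence F(h) = J pointwise, and a continuous h with values in the finite set
   {F = J} is constant.

   Integrals are replaced by explicit antiderivatives. Wirtinger's inequality
   is proved by picking a with h'(a) = h'(a + pi) and observing, for
   k = h' - h'(a), that
     k'^2 - k^2 - (k^2 cot(x - a))' = (k' - k cot(x - a))^2 >= 0
   on both half-periods following a. *)

Section Proposition4p2.
Context {R : realType}.
Implicit Types k s : R -> R.

(** * Preliminaries on limits, translates and half-periods *)

(** At [z] the quotient is 0 / 0, which evaluates to 0. It equals [k] times the ratio of the
    difference quotients of [k] and [s], hence tends to 0 * (dk / ds) = 0. This handles k^2 cot at
    the ends of a half-period. *)
Lemma continuous_sqr_div k s (z dk ds : R) :
  is_derive z 1 k dk -> is_derive z 1 s ds -> k z = 0 -> s z = 0 -> ds != 0 ->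
  {for z, continuous (fun x => k x ^+ 2 / s x)}.
Proof.
move=> dkz dsz kz0 sz0 ds0.
have cvgq f df : is_derive z 1 f df -> f z = 0 ->
    t^-1 * f (t + z) @[t --> 0^'] --> df.
  move=> dfz fz0; have [+ <-] := dfz; rewrite /derivable /derive fz0.
  suff -> : (fun t : R => t^-1 *: ((f \o shift z) (t *: 1) - 0)) =
    (fun t => t^-1 * f (t + z)) by [].
  by apply/funext => t; rewrite subr0 /= /GRing.scale /= mulr1.
have ck : k (t + z) @[t --> 0^'] --> 0.
  have cid : (t : R) @[t --> 0^'] --> (0 : R)
    by apply/(continuous_withinNx (@id R) 0).1; exact: cvg_id.
  have H : t * (t^-1 * k (t + z)) @[t --> 0^'] --> 0 * dk.
    exact: cvgM cid (cvgq _ _ dkz kz0).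
  rewrite mul0r in H.
  apply: (cvg_trans _ H).
  apply: near_eq_cvg; near=> t; rewrite /= mulrA divff ?mul1r//.
  by near: t; exact: nbhs_dnbhs_neq.
pose q x := k x ^+ 2 / s x.
have -> : {for z, continuous q} = {for 0, continuous (q \o shift z)}.
  by rewrite /prop_for /continuous_at [RHS]/= cvg_comp_shift !add0r.
apply/continuous_withinNx; rewrite /q /= add0r kz0 expr0n mul0r.
have H : k (t + z) * (t^-1 * k (t + z) * (t^-1 * s (t + z))^-1) @[t --> 0^']
    --> 0 * (dk * ds^-1).
  apply: cvgM => //; apply: cvgM; first exact: cvgq.
  by apply: cvgV => //; exact: cvgq.
rewrite mul0r in H; apply: (cvg_trans _ H).
apply: near_eq_cvg; near=> t; rewrite /= invfM invrK.
have t0 : t != 0 by near: t; exact: nbhs_dnbhs_neq.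
by rewrite expr2 mulrACA mulVf// mul1r mulrA.
Unshelve. all: by end_near.
Qed.

Lemma is_derive_translate (f : R -> R) (b x df : R) :
  is_derive (x - b) 1 f df -> is_derive x 1 (fun y => f (y - b)) df.
Proof.
move=> dfx; have dB : is_derive x 1 (id - cst b) (1 - 0).
  exact: is_deriveB.
by have := @is_derive1_comp _ f _ x _ _ dfx dB; rewrite subr0 mulr1.
Qed.

(** By periodicity, g(x + pi) - g(x) changes sign when x moves by pi, so the intermediate value
    theorem gives a zero. *)
Lemma halfperiod_repeat (g : R -> R) (x0 : R) :
  continuous g -> periodic g (2 * pi) ->
  exists2 a, a \in `[x0, x0 + pi] & g (a + pi) = g a.
Proof.
move=> cg pg.
have cD : {within `[x0, x0 + pi], continuous (fun x => g (x + pi) - g x)}.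
  apply: continuous_subspaceT => x.
  apply: cvgB; last exact: cg.
  apply: continuous_comp; last exact: cg.
  by apply: cvgD; [exact: cvg_id|exact: cvg_cst].
have e2 : x0 + pi + pi = x0 + 2 * pi by ring.
have [||a aI /eqP] := @IVT _ _ x0 (x0 + pi) 0 _ cD.
- by rewrite lerDl pi_ge0.
- rewrite e2 pg -[g x0 - _]opprB ge_min le_max !oppr_le0 !oppr_ge0.
  by have /orP[->|->] := le_total 0 (g (x0 + pi) - g x0); rewrite ?orbT.
- by rewrite subr_eq0 => /eqP gap; exists a.
Qed.

(** * Wirtinger's inequality on a half-period and its equality case *)

(** The increment of [M] stands for the integral of k'^2 - k^2. Subtracting k^2 cot(x - b) leaves
    the end values unchanged and turns the derivative into a square. In the equality case this
    square vanishes. *)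
Lemma wirtinger_half k (k' : R -> R) (M : R -> R) (b : R) :
  (forall x : R, is_derive x 1 k (k' x)) ->
  (forall x : R, is_derive x 1 M (k' x ^+ 2 - k x ^+ 2)) ->
  k b = 0 -> k (b + pi) = 0 ->
  M b <= M (b + pi) /\
  (M b = M (b + pi) ->
    {in `]b, b + pi[, forall x, k' x * sin (x - b) = k x * cos (x - b)}).
Proof.
move=> dk dM kb0 kp0.
pose P x := M x - k x ^+ 2 / sin (x - b) * cos (x - b).
have bI : b \in `[b, b + pi] by rewrite in_itv/= lexx lerDl pi_ge0.
have pI : b + pi \in `[b, b + pi] by rewrite in_itv/= lexx lerDl pi_ge0.
have Pb : P b = M b by rewrite /P kb0 expr0n !mul0r subr0.
have Pp : P (b + pi) = M (b + pi) by rewrite /P kp0 expr0n !mul0r subr0.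
have sgt0 x : x \in `]b, b + pi[ -> 0 < sin (x - b).
  by rewrite in_itv/= => /andP[bx xb]; rewrite sin_gt0_pi// subr_gt0 bx ltrBlDl.
have ds x := is_derive_translate (is_derive_sin (x - b)).
have dc x := is_derive_translate (is_derive_cos (x - b)).
have dP x : x \in `]b, b + pi[ ->
    is_derive x 1 P ((k' x - k x * cos (x - b) / sin (x - b)) ^+ 2).
  move=> /sgt0 sx; have s0 : sin (x - b) != 0 by rewrite gt_eqF.
  have dV := is_deriveV s0 (ds x).
  have dPx := is_deriveB (dM x)
    (is_deriveM (is_deriveM (is_deriveX 2 (dk x)) dV) (dc x)).
  apply: (is_derive_eq dPx); rewrite /GRing.scale/= /GRing.exp/=.
  by rewrite !fctE; field.
have cM x : {for x, continuous M}.
  by apply/differentiable_continuous/derivable1_diffP; case: (dM x).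
have cc x : {for x, continuous (fun x => cos (x - b))}.
  by apply/differentiable_continuous/derivable1_diffP; case: (dc x).
have cP : {in `[b, b + pi], forall x, {for x, continuous P}}.
  move=> x xI.
  have [xO|xE] := boolP (x \in `]b, b + pi[).
    by apply/differentiable_continuous/derivable1_diffP; case: (dP x xO).
  (* At an endpoint the sine and [k] vanish together, while the derivative of the sine is
     [cos (x - b) != 0], so [continuous_sqr_div] applies. *)
  have [sx0 cx0 kx0] : [/\ sin (x - b) = 0, cos (x - b) != 0 & k x = 0].
    move: xI xE; rewrite !in_itv/= => /andP[bx xp].
    rewrite negb_and -!leNgt => /orP[xb|px].
      have -> : x = b by apply/eqP; rewrite eq_le xb bx.
      by rewrite subrr sin0 cos0 oner_neq0.
    have -> : x = b + pi by apply/eqP; rewrite eq_le xp px.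
    by rewrite [b + pi]addrC addrK sinpi cospi oppr_eq0 oner_neq0 addrC.
  apply: cvgB; first exact: cM.
  apply: cvgM; last exact: cc.
  exact: (continuous_sqr_div (dk x) (ds x)).
have cPw : {within `[b, b + pi], continuous P}.
  by apply: continuous_in_subspaceT => x /set_mem; exact: cP.
have homoP : {in `[b, b + pi] &, {homo P : x y / x <= y}}.
  apply: ger0_derive1_le_cc => // x xO; first by case: (dP x xO).
  by have [_] := dP x xO; rewrite derive1E => ->; rewrite sqr_ge0.
split=> [|Mbp x xO].
  by rewrite -Pb -Pp homoP// lerDl pi_ge0.
(* A nondecreasing function with equal end values is constant. *)
have Pcst y : y \in `]b, b + pi[ -> P y = M b.
  move=> yO; have yI := subset_itv_oo_cc yO.
  move: (yO); rewrite in_itv/= => /andP[/ltW by_ /ltW yp].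
  by apply/eqP; rewrite eq_le {1}Mbp -Pp -Pb !homoP.
have [_ dPx0] : is_derive x 1 P 0.
  apply: (derive1_at_min _ _ xO) => [|y yO|y yO]; first by rewrite lerDl pi_ge0.
  - by case: (dP y yO).
  - by rewrite !Pcst.
have [_] := dP x xO; rewrite dPx0 => /esym/eqP.
rewrite sqrf_eq0 subr_eq0 => /eqP ->.
by rewrite divfK// gt_eqF// sgt0.
Qed.

(* Periodicity of [E] expresses that [h1 ^+ 2] and [h2 ^+ 2] have the same
   integral over a period. *)
Lemma wirtinger_equality (h h1 h2 h3 E : R -> R) (x : R) :
  (forall x : R, is_derive x 1 h (h1 x)) ->
  (forall x : R, is_derive x 1 h1 (h2 x)) ->
  (forall x : R, is_derive x 1 h2 (h3 x)) ->
  (forall x : R, is_derive x 1 E (h1 x ^+ 2 - h2 x ^+ 2)) ->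
  periodic h (2 * pi) -> periodic h1 (2 * pi) -> periodic E (2 * pi) ->
  exists2 a, x \in `[a, a + pi] &
    {in `]a, a + pi[, forall y, h1 y + h3 y = 0}.
Proof.
move=> dh dh1 dh2 dE ph ph1 pE.
have ch1 : continuous h1.
  by move=> y; apply/differentiable_continuous/derivable1_diffP; case: (dh1 y).
(* Starting the search at [x - pi] puts [x] in the first half-period after [a]. *)
have [a aI gap] := halfperiod_repeat (x - pi) ch1 ph1.
exists a.
  by move: aI; rewrite !in_itv/= subrK lerBlDr => /andP[-> ->].
pose g := h1 a.
(* Expanding (h1 - g)^2 shows that this is an antiderivative of h2^2 - (h1 - g)^2. The first two
   terms are periodic and the last one drifts. *)
pose M := (2 * g) *: h - E - (g ^+ 2) *: id.
pose k := h1 - cst g.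
have dk (y : R) : is_derive y 1 k (h2 y).
  apply: (is_derive_eq (is_deriveB (dh1 y) (is_derive_cst g y 1))).
  by rewrite subr0.
have dM (y : R) : is_derive y 1 M (h2 y ^+ 2 - k y ^+ 2).
  apply: (is_derive_eq (is_deriveB (is_deriveB (is_deriveZ (2 * g) (dh y))
    (dE y)) (is_deriveZ (g ^+ 2) (is_derive_id y 1)))).
  by rewrite /k /= /GRing.scale/= !fctE; ring.
have e2 y : y + pi + pi = y + 2 * pi by ring.
have ka : k a = 0 by rewrite /k !fctE subrr.
have kap : k (a + pi) = 0 by rewrite /k !fctE gap subrr.
have kapp : k (a + pi + pi) = 0 by rewrite e2 /k !fctE ph1 subrr.
have [le1 eqM] := wirtinger_half dk dM ka kap.
have [le2 _] := wirtinger_half dk dM kap kapp.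
have Mapp : M (a + pi + pi) = M a - 2 * pi * g ^+ 2.
  by rewrite e2 /M !fctE ph pE /GRing.scale/=; ring.
(* Over a full period [M] drops by 2 pi g^2, yet the two half-period inequalities say that it does
   not decrease. *)
have g2 : g ^+ 2 = 0.
  apply/eqP; rewrite eq_le sqr_ge0 andbT.
  have := le_trans le1 le2; rewrite Mapp lerDl oppr_ge0.
  by rewrite pmulr_rle0 ?mulr_gt0 ?pi_gt0//.
have g0 : g = 0 by apply/eqP; rewrite -sqrf_eq0 g2.
have Eq : M a = M (a + pi).
  by apply/eqP; rewrite eq_le le1 (le_trans le2)// Mapp g2 mulr0 subr0.
have kh : k = h1 by rewrite /k g0; apply/funext => y; rewrite !fctE subr0.
move=> y yO.
(* The equality case makes [D] vanish on the open half-period, while its derivative is (h1 + h3)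
   sin(y - a) with a positive sine. *)
pose D := h2 * (fun y => sin (y - a)) - h1 * (fun y => cos (y - a)).
have dD := is_deriveB
  (is_deriveM (dh2 y) (is_derive_translate (is_derive_sin (y - a))))
  (is_deriveM (dh1 y) (is_derive_translate (is_derive_cos (y - a)))).
have D0 : is_derive y 1 D 0.
  apply: (near_eq_is_derive (f := cst 0)).
  near=> z; have zO : z \in `]a, a + pi[ by near: z; exact: near_in_itvoo.
  by have := eqM Eq z zO; rewrite kh /D !fctE => ->; rewrite subrr.
have [_] := dD; have [_ ->] := D0; rewrite /GRing.scale/= => /esym/eqP.
have -> : h2 y * cos (y - a) + sin (y - a) * h3 y -
    (h1 y * - sin (y - a) + cos (y - a) * h2 y) =
    (h1 y + h3 y) * sin (y - a) by ring.
rewrite mulf_eq0 => /orP[/eqP//|]; rewrite gt_eqF// sin_gt0_pi//.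
by move: yO; rewrite in_itv/= subr_gt0 ltrBlDl.
Unshelve. all: by end_near.
Qed.

(** * From the equality case to constant solutions *)

(** One-sided limits reach the endpoints. This is needed because the given point may be an end of
    the half-period, where the equality case says nothing. *)
Lemma eq_cst_itvcc (f : R -> R) (a b c : R) : a < b -> continuous f ->
  {in `]a, b[, forall x, f x = c} -> {in `[a, b], forall x, f x = c}.
Proof.
move=> ab cf fc x; rewrite in_itv/= => /andP[].
have eqc y (G : set_system R) : ProperFilter G -> f @ G --> f y ->
    (\forall z \near G, z \in `]a, b[) -> f y = c.
  move=> PG fy Gab; rewrite -(cvg_lim _ fy)//; apply: cvg_lim => //.
  have cG : (fun=> c) z @[z --> G] --> c by exact: cvg_cst.
  apply: (cvg_trans _ cG); apply: near_eq_cvg.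
  by near=> z; rewrite fc//; near: z.
rewrite le_eqVlt => /orP[/eqP <- _|ax].
  apply: (eqc a a^'+ _ (cvg_at_right_filter (cf a))).
  near=> z; rewrite in_itv/=; apply/andP; split; near: z.
    exact: nbhs_right_gt.
  exact: nbhs_right_lt.
rewrite le_eqVlt => /orP[/eqP ->|xb].
  apply: (eqc b b^'- _ (cvg_at_left_filter (cf b))).
  near=> z; rewrite in_itv/=; apply/andP; split; near: z.
    exact: nbhs_left_gt.
  exact: nbhs_left_lt.
by apply: fc; rewrite in_itv/= ax xb.
Unshelve. all: by end_near.
Qed.

Lemma steady_zeroth_order (F Phi h : R -> R) (J : R) :
  continuous F ->
  (forall y : R, 0 < y -> is_derive y 1 Phi ((J - F y) / y ^+ 3)) ->
  positive_periodic_solution F J h ->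
  forall x, F (h x) = J.
Proof.
move=> cF dPhi [dh hgt0 ph heq] x.
pose h1 := (h^`(1))%classic; pose h2 := (h^`(2))%classic.
pose h3 := (h^`(3))%classic.
have D0 (y : R) : is_derive y 1 h (h1 y).
  by apply: DeriveDef; [exact: (dh 0)|rewrite /h1 -derive1E].
have D1 (y : R) : is_derive y 1 h1 (h2 y).
  by apply: DeriveDef; [exact: (dh 1)|rewrite /h2 derive1nS -derive1E].
have D2 (y : R) : is_derive y 1 h2 (h3 y).
  by apply: DeriveDef; [exact: (dh 2)|rewrite /h3 derive1nS -derive1E].
have pderiv (f f' : R -> R) : (forall y : R, is_derive y 1 f (f' y)) ->
    periodic f (2 * pi) -> periodic f' (2 * pi).
  move=> df pf y.
  have := is_derive_translate (b := - (2 * pi)) (x := y) (f := f).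
  rewrite opprK => /(_ _ (df _)).
  under eq_fun => z do rewrite pf.
  by case=> _ <-; case: (df y) => _ <-.
have p1 := pderiv _ _ D0 ph; have p2 := pderiv _ _ D1 p1.
(* By the equation, (Phi o h)' = (h1 + h3) h1, and subtracting (h1 h2)' = h2^2 + h1 h3 cancels the
   third derivative. *)
have DE (y : R) : is_derive y 1 (Phi \o h - h1 * h2) (h1 y ^+ 2 - h2 y ^+ 2).
  apply: (is_derive_eq (is_deriveB (is_derive1_comp (dPhi _ (hgt0 y)) (D0 y))
    (is_deriveM (D1 y) (D2 y)))).
  have -> : J - F (h y) = h y ^+ 3 * (h1 y + h3 y).
    by rewrite -(heq y) /h1 /h3; ring.
  rewrite /GRing.scale/=; field.
  by rewrite gt_eqF.
have pE : periodic (Phi \o h - h1 * h2) (2 * pi).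
  by move=> y; rewrite !fctE/= ph p1 p2.
have [a xI h13] := wirtinger_equality x D0 D1 D2 DE ph p1 pE.
have FhO y : y \in `]a, a + pi[ -> F (h y) = J.
  by move=> /h13 h130; rewrite -(heq y) -/h1 -/h3 h130 mulr0 addr0.
have ch : continuous h.
  by move=> y; apply/differentiable_continuous/derivable1_diffP; case: (D0 y).
apply: (eq_cst_itvcc _ _ FhO xI).
- by rewrite ltrDl pi_gt0.
- by move=> y; apply: continuous_comp; [exact: ch|exact: cF].
Qed.

(** Two values of [u] agree up to sign. If they are opposite, [u] has a zero between them, so [K] =
    0 and [u] vanishes everywhere. *)
Lemma continuous_sqr_cst (u : R -> R) (K : R) :
  continuous u -> (forall x, u x ^+ 2 = K) -> forall x y, u x = u y.
Proof.
move=> cu uK.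
have aux x y : x <= y -> u x = u y.
  move=> xy; have : u x ^+ 2 = u y ^+ 2 by rewrite !uK.
  move/eqP; rewrite eqf_sqr => /orP[/eqP//|/eqP uxy].
  have [|z _ uz0] := @IVT _ u x y 0 xy (continuous_subspaceT cu).
    rewrite uxy ge_min le_max oppr_le0 oppr_ge0.
    by have /orP[->|->] := le_total 0 (u y); rewrite ?orbT.
  have u0 w : u w = 0 by apply/eqP; rewrite -sqrf_eq0 uK -(uK z) uz0 expr0n.
  by rewrite !u0.
by move=> x y; have /orP[/aux|/aux] := le_total x y.
Qed.

Lemma solution_a_zeroth_order (c J : R) (h : R -> R) :
  solution_a c J h -> forall x, - c * h x + h x ^+ 2 / 2 = J.
Proof.
move=> sol.
apply: (@steady_zeroth_order (fun y => - c * y + y ^+ 2 / 2)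
  (* Termwise antiderivative of J / y^3 + c / y^2 - 1 / (2 y). *)
  (fun y => - (J / 2) * (y^-1 * y^-1) - c * y^-1 - 2^-1 * ln y)) sol.
- move=> y; apply: cvgD; first by apply: cvgM; [exact: cvg_cst|exact: cvg_id].
  by apply: cvgM; [exact: exprn_continuous|exact: cvg_cst].
- move=> y y0; have yn0 : y != 0 by rewrite gt_eqF.
  have dV := is_deriveV yn0 (is_derive_id y 1).
  have dl := is_derive1_ln y0.
  have dPhi := is_deriveB (is_deriveB (is_deriveZ (- (J / 2)) (is_deriveM dV dV))
    (is_deriveZ c dV)) (is_deriveZ 2^-1 dl).
  by apply: (is_derive_eq dPhi); rewrite /GRing.scale/=; field.
Qed.

Lemma solution_a_cst (c J : R) (h : R -> R) :
  solution_a c J h -> forall x y, h x = h y.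
Proof.
move=> sol; have hJ := solution_a_zeroth_order sol.
have [dh _ _ _] := sol.
have ch : continuous h.
  by move=> y; apply/differentiable_continuous/derivable1_diffP; exact: (dh 0).
have cu : continuous (fun x => h x - c).
  by move=> y; apply: cvgB; [exact: ch|exact: cvg_cst].
(* Completing the square in F(h) = J. *)
have uK x : (h x - c) ^+ 2 = 2 * J + c ^+ 2 by rewrite -(hJ x); field.
by move=> x y; apply: (addIr (- c)); exact: (continuous_sqr_cst cu uK).
Qed.

(** Here F(y) = - c y is injective, so F(h) = J = F(hstar) determines [h] pointwise. *)
Lemma solution_b_cst (c hstar : R) (h : R -> R) : c != 0 ->
  solution_b c (- c * hstar) h -> forall x, h x = hstar.
Proof.
move=> c0 sol x; apply: (@mulfI _ (- c)); first by rewrite oppr_eq0.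
apply: (@steady_zeroth_order (fun y => - c * y)
  (fun y => (c * hstar / 2) * (y^-1 * y^-1) - c * y^-1)) sol x.
- by move=> y; apply: cvgM; [exact: cvg_cst|exact: cvg_id].
- move=> y y0; have yn0 : y != 0 by rewrite gt_eqF.
  have dV := is_deriveV yn0 (is_derive_id y 1).
  have dPhi := is_deriveB (is_deriveZ (c * hstar / 2) (is_deriveM dV dV))
    (is_deriveZ c dV).
  by apply: (is_derive_eq dPhi); rewrite /GRing.scale/=; field.
Qed.

(** * Norm of a constant, constant solutions and conclusion *)

Lemma Linfty_norm_cst (a : R) : Linfty_norm (fun=> a) = `|a|%:E.
Proof.
rewrite /Linfty_norm Lnorm.unlock.
(* The norm is an essential supremum only when the total measure is positive; here that measure is 2
   pi. *)
have mu0 : (0 < mrestr (@lebesgue_measure R)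
    (measurable_itv `[0%R, (2 * pi)%R]) [set: R])%E.
  rewrite /mrestr setTI lebesgue_measure_itv/= lte_fin mulr_gt0 ?pi_gt0//.
  by rewrite sube0 lte_fin mulr_gt0 ?pi_gt0.
by rewrite mu0; exact: ess_sup_cst.
Qed.

Lemma positive_periodic_solution_cst (F : R -> R) (a : R) :
  0 < a -> positive_periodic_solution F (F a) (fun=> a).
Proof.
move=> a0; have d0 n : ((fun=> a : R)^`(n.+1))%classic = cst (0 : R).
  by elim: n => [|n IH]; rewrite derive1nS ?IH; apply/funext => x;
     exact: derive1_cst.
split=> // [[|k] x _|x].
- exact: derivable_cst.
- by rewrite d0; exact: derivable_cst.
- by rewrite !d0 addr0 mulr0 addr0.
Qed.

End Proposition4p2.

Theorem proposition4p2 (R : realType) :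
  ((forall hstar c : R, 0 < hstar ->
      solution_a c (- c * hstar + hstar ^+ 2 / 2) (fun=> hstar)) /\
   (forall L : R, 0 < L -> exists2 eps : R, 0 < eps &
      forall (c hstar : R) (h : R -> R),
        - L <= c <= L ->
        1 / L <= hstar <= L ->
        - (c ^+ 2 / 2) <= - c * hstar + hstar ^+ 2 / 2 <= L ->
        solution_a c (- c * hstar + hstar ^+ 2 / 2) h ->
        (Linfty_norm (fun theta => h theta - hstar)%R <= eps%:E)%E ->
        exists2 htilde : R, constant_states eps hstar c htilde &
          forall theta, h theta = htilde)) /\
  ((forall hstar c : R, 0 < hstar ->
      solution_b c (- c * hstar) (fun=> hstar)) /\
   (forall L : R, 0 < L -> exists2 eps : R, 0 < eps &
      forall (c hstar : R) (h : R -> R),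
        1 / L <= c <= L ->
        0 < hstar ->
        - L <= - c * hstar <= L ->
        solution_b c (- c * hstar) h ->
        (Linfty_norm (fun theta => h theta - hstar)%R <= eps%:E)%E ->
        forall theta, h theta = hstar)).
Proof.
split; split.
- move=> hstar c h0.
  exact: (positive_periodic_solution_cst (fun y => - c * y + y ^+ 2 / 2)).
(* The witness 1 is an arbitrary positive number. Once [h] is constant its norm distance to [hstar]
   is [|h 0 - hstar|], so the norm bound places [h 0] in the interval of [constant_states]. *)
- move=> L L0; exists 1 => // c hstar h _ _ _ sol.
  have hc := solution_a_cst sol.
  have -> : (fun theta => h theta - hstar) = (fun=> h 0 - hstar).
    by apply/funext => x; rewrite (hc x 0).
  rewrite Linfty_norm_cst lee_fin => hb.
  exists (h 0) => //; split; first by rewrite in_itv/= -ler_distl.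
  exact: (solution_a_zeroth_order sol).
- move=> hstar c h0.
  exact: (positive_periodic_solution_cst (fun y => - c * y)).
- move=> L L0; exists 1 => // c hstar h /andP[cL _] _ _ sol _.
  apply: solution_b_cst sol; rewrite gt_eqF//.
  by rewrite (lt_le_trans _ cL)// divr_gt0.
Qed.
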